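(* Let $n\ge 2$. Assume that we have a solvable linear system of $n$ equations in the variables $x_1,\ldots,x_n$, in which every equation is of one of the two types $$x_i+x_j=x_k\qquad\text{and}\qquad x_l=1 .$$ Then the system has a rational solution with $|x_i|\le 2^{n-1}$ for all $1\le i\le n$. This result is sharp: for every $n\ge 2$ there is a solvable system of $n$ equations of these types in $x_1,\ldots,x_n$ for which every solution satisfies $\max_{1\le i\le n}|x_i|=2^{n-1}$.
   Context: The indices $i,j,k$ in an equation $x_i+x_j=x_k$ range over $\{1,\ldots,n\}$ and need not be distinct. Solvable means having a real solution. *)

(* Defs.v *)
From HB Require Import structures.
From mathcomp Require Import all_boot all_order all_algebra.
From mathcomp Require Import reals.
Set Implicit Arguments.
Unset Strict Implicit.
Unset Printing Implicit Defensive.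

Import Order.TTheory GRing.Theory Num.Theory.
Local Open Scope ring_scope.

(* The variables x_1, ..., x_n are indexed by 'I_n, i.e. by 0, ..., n-1. *)
Inductive equation (n : nat) : Type :=
| SumEq of 'I_n & 'I_n & 'I_n  (* SumEq i j k stands for x_i + x_j = x_k *)
| OneEq of 'I_n.               (* OneEq l stands for x_l = 1 *)

Definition satisfies (F : nzRingType) (n : nat) (x : 'I_n -> F)
    (e : equation n) : Prop :=
  match e with
  | SumEq i j k => x i + x j = x k
  | OneEq l => x l = 1
  end.

(* A system is a list of equations, in which repetitions are allowed. *)
Definition is_solution (F : nzRingType) (n m : nat)
    (S : m.-tuple (equation n)) (x : 'I_n -> F) : Prop :=
  forall q : 'I_m, satisfies x (tnth S q).

Definition solvable (R : realType) (n m : nat)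
    (S : m.-tuple (equation n)) : Prop :=
  exists x : 'I_n -> R, is_solution S x.

(* Main.v *)
Require Import Defs.
From HB Require Import structures.
From mathcomp Require Import all_boot all_order all_algebra.
From mathcomp Require Import reals.
Set Implicit Arguments.
Unset Strict Implicit.
Unset Printing Implicit Defensive.

Import Order.TTheory GRing.Theory Num.Theory.
Local Open Scope ring_scope.

(** Write the system as [A x = b].  A solvable system has a basic solution,
    supported on linearly independent columns, and by Cramer's rule each of its
    coordinates is, up to sign, a minor of the augmented matrix [(A | -b)]
    divided by a nonzero minor of [A] ([rational_solution_of_minors]).  The
    entries are integers, so the denominator is at least 1 in absolute value and
    it suffices to bound the minors of [(A | -b)].

    Call a row a network row if it is [e_p - e_q], where either term may be
    absent.  A determinant with network rows only is 0, 1 or -1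
    ([norm_det_network]).  The row of [x_l = 1] in [(A | -b)] is a network row,
    and that of [x_i + x_j = x_k] is the sum of the two network rows [e_i] and
    [e_j - e_k].  Expanding by multilinearity in the latter rows, a minor with
    [s] of them is a sum of [2 ^ s] determinants in {-1, 0, 1}
    ([norm_det_network_sum]).  Unless the zero vector is a solution, some
    equation is [x_l = 1], so [s <= n - 1], whence the bound [2 ^ (n - 1)].

    Sharpness comes from repeated doubling: the equations [x_1 = 1] and
    [x_i + x_i = x_(i+1)] force [x_n = 2 ^ (n - 1)]. *)

(** * Determinants of network matrices *)

(** The row is [e_p - e_q], where an index [None] contributes nothing: the
    incidence vector of an arc one of whose ends may be missing.  With options
    the property survives the deletion of columns. *)
Definition network (R : pzRingType) (r : nat) (u : 'rV[R]_r) : Prop :=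
  exists p q : option 'I_r,
    forall k, u 0 k = (p == Some k)%:R - (q == Some k)%:R.

Lemma network_colsub (R : pzRingType) r s (h : 'I_s -> 'I_r) (u : 'rV[R]_r) :
  injective h -> network u -> network (colsub h u).
Proof.
move=> hI [p [q uE]].
have preim o : exists o', forall k, (o == Some (h k)) = (o' == Some k).
  case: o => [i|]; last by exists None.
  case: (pickP (fun k => h k == i)) => [k0 /eqP <-|none].
    by exists (Some k0) => k; rewrite !(inj_eq Some_inj) (inj_eq hI).
  by exists None => k; rewrite (inj_eq Some_inj) eq_sym none.
have [[p' pE] [q' qE]] := (preim p, preim q).
by exists p', q' => k; rewrite mxE uE pE qE.
Qed.

(** Matrices whose rows are network rows are totally unimodular.  If every row
    has both ends, the columns add up to zero and so does the determinant;
    otherwise some row has at most one nonzero entry, which is a sign, and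
    expanding along it leaves a smaller network matrix. *)
Lemma norm_det_network (R : numDomainType) r (M : 'M[R]_r) :
  (forall i, network (row i M)) -> `|\det M| <= 1.
Proof.
elim: r M => [|r IHr] M netM; first by rewrite det_mx00 normr1.
have [p] := fin_all_exists netM.
case/fin_all_exists => q pqE.
have {}pqE i k : M i k = (p i == Some k)%:R - (q i == Some k)%:R.
  by rewrite -pqE mxE.
have sum1 (o : option 'I_r.+1) :
    \sum_k ((o == Some k)%:R : R) = (o != None)%:R.
  case: o => [i|]; last by rewrite big1.
  rewrite (bigD1 i) //= eqxx big1 ?addr0 // => k /negPf ki.
  by rewrite (inj_eq Some_inj) eq_sym ki.
case: (boolP [exists i, (p i == None) || (q i == None)]); last first.
  rewrite negb_exists => /forallP full.
  (* Every row sums to zero, so the all-ones column lies in the kernel. *)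
  suff /eqP-> : \det M == 0 by rewrite normr0 ler01.
  rewrite -det_tr; apply/det0P; exists (const_mx 1).
    by apply/eqP=> /rowP/(_ ord0); rewrite !mxE => /eqP; rewrite oner_eq0.
  apply/rowP=> i; rewrite !mxE.
  under eq_bigr do rewrite !mxE mul1r pqE.
  rewrite sumrB !sum1; have := full i.
  by rewrite negb_or => /andP[-> ->]; rewrite subrr.
case/existsP=> i piqi.
have [k [s [s1 rowE]]] :
    exists k s, `|s| <= 1 :> R /\ forall j, M i j = s * (j == k)%:R.
  case pi: (p i) (pqE i) piqi => [k|] pqi; case qi: (q i) pqi => [l|] // pqi _.
  - exists k, 1; rewrite normr1; split=> // j.
    by rewrite pqi subr0 mul1r (inj_eq Some_inj) eq_sym.
  - exists l, (-1); rewrite normrN1; split=> // j.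
    by rewrite pqi sub0r mulN1r (inj_eq Some_inj) eq_sym.
  - exists ord0, 0; rewrite normr0 ler01; split=> // j.
    by rewrite pqi subrr mul0r.
rewrite (expand_det_row _ i) (bigD1 k) //= big1 ?addr0; last first.
  by move=> j /negPf jk; rewrite rowE jk mulr0 mul0r.
rewrite rowE eqxx mulr1 normrM mulr_ile1 // /cofactor normrMsign.
apply: IHr => i'.
have -> : row i' (row' i (col' k M)) = colsub (lift k) (row (lift i i') M).
  by apply/rowP=> j; rewrite !mxE.
exact: network_colsub (@lift_inj _ _) (netM _).
Qed.

(** By multilinearity, a row that is a sum of two network rows splits the
    determinant into two, so each such row costs a factor 2.  This is sharper
    than Hadamard's inequality, where a row such as [(2, -1)] would cost
    [sqrt 5]. *)
Lemma norm_det_network_sum (R : numDomainType) r (M : 'M[R]_r)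
    (P : {set 'I_r}) :
  (forall i, i \notin P -> network (row i M)) ->
  (forall i, i \in P ->
     exists u v, [/\ network u, network v & row i M = u + v]) ->
  `|\det M| <= 2 ^+ #|P|.
Proof.
move: {2}#|P| (erefl #|P|) => c; elim: c P M => [|c IHc] P M cardP net1 net2.
  rewrite cardP expr0; apply: norm_det_network => i; apply: net1.
  by rewrite (cards0_eq cardP) inE.
have [i iP] : exists i, i \in P by apply/card_gt0P; rewrite cardP.
have cardPi : #|P :\ i| = c.
  by apply/eqP; rewrite -eqSS -cardP (cardsD1 i P) iP.
pose subst w := \matrix_(i', j) if i' == i then (w : 'rV[R]_r) 0 j else M i' j.
have rowS w : row i (subst w) = w by apply/rowP=> j; rewrite !mxE eqxx.
have rowS' w i' : i' != i -> row i' (subst w) = row i' M.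
  by move=> /negPf i'i; apply/rowP=> j; rewrite !mxE i'i.
have row'S w : row' i (subst w) = row' i M.
  by apply/matrixP=> k j; rewrite !mxE eq_sym (negPf (neq_lift _ _)).
have bound w : network w -> `|\det (subst w)| <= 2 ^+ c.
  move=> netw; rewrite -cardPi; apply: IHc => // i'; rewrite !inE.
    rewrite negb_and negbK; have [-> _|i'i /= /net1] := eqVneq i' i.
      by rewrite rowS.
    by rewrite rowS'.
  by case/andP=> i'i /net2; rewrite rowS'.
have [u [v [netu netv rowM]]] := net2 i iP.
have -> : \det M = 1 * \det (subst u) + 1 * \det (subst v).
  apply: (determinant_multilinear (i0 := i)); rewrite ?row'S //.
  by rewrite !rowS !scale1r.
rewrite !mul1r cardP exprS mulr_natl mulr2n.
by apply: le_trans (ler_normD _ _) _; rewrite lerD ?bound.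
Qed.

(** * Small rational solutions from bounds on minors *)

(** The columns [g] form a basis of the column space, so [b] has coordinates [y]
    in it; the rows [f] cut out an invertible square block, so that [y] is
    determined by the equations in [f] alone. *)
Lemma basic_solution (F : fieldType) m n (A : 'M[F]_(m, n)) (b : 'cV[F]_m) :
  (b^T <= A^T)%MS ->
  exists (r : nat) (f : 'I_r -> 'I_m) (g : 'I_r -> 'I_n) (y : 'cV[F]_r),
    [/\ injective f, injective g, mxsub f g A \in unitmx
      & colsub g A *m y = b].
Proof.
set g := maxrankfun A^T; rewrite -(eq_maxrowsub A^T) -/g => /submxP[y bE].
have fullA : row_full (colsub g A).
  rewrite -[colsub g A]trmxK trmx_mxsub /row_full mxrank_tr.
  exact: maxrowsub_free.
exists _, (fullrankfun fullA), g, y^T; split.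
- exact: fullrankfun_inj.
- exact: maxrankfun_inj.
- by have := fullrowsub_unit fullA; rewrite -mxsub_comp.
- by rewrite -[b]trmxK bE trmx_mul trmx_mxsub trmxK.
Qed.

(** Solvability is a rank condition, hence descends from [R] to the rationals.
    Cramer's rule writes a coordinate of a basic solution as a quotient, up to
    sign, of two minors of the augmented matrix; the denominator is a nonzero
    integer, so the numerator alone bounds the coordinate.  The sign in
    [- b] is what makes the rows of the equations [x_l = 1] network rows. *)
Lemma rational_solution_of_minors (R : numFieldType) m n
    (A : 'M[int]_(m, n)) (b : 'cV[int]_m) (c : int) :
  (forall r (f : 'I_r -> 'I_m) (g : 'I_r -> 'I_(n + 1)),
     injective f -> injective g ->
     `|\det (mxsub f g (row_mx A (- b)))| <= c) ->
  (exists x : 'cV[R]_n, map_mx intr A *m x = map_mx intr b) ->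
  exists x : 'cV[rat]_n,
    map_mx intr A *m x = map_mx intr b /\ forall i, `|x i 0| <= c%:~R.
Proof.
move=> minor_le [z zE].
(* The empty minor is 1. *)
have c_ge0 : 0 <= c.
  have void T (i : 'I_0) : T by case: i.
  by apply: le_trans (minor_le 0 (void _) (void _) _ _) => // - [].
pose A' : 'M[rat]_(m, n) := map_mx intr A.
pose b' : 'cV[rat]_m := map_mx intr b.
have /basic_solution[r [f [g [y [fI gI unitD yE]]]]] : (b'^T <= A'^T)%MS.
  have ratrE k l (M : 'M[int]_(k, l)) :
      map_mx (ratr : rat -> R) (map_mx intr M) = map_mx intr M.
    by apply/matrixP=> i j; rewrite !mxE ratr_int.
  rewrite -(map_submx (ratr : {rmorphism rat -> R})) -!map_trmx !ratrE.
  by apply/submxP; exists z^T; rewrite -trmx_mul zE.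
exists (colsub g 1%:M *m y); split.
  by rewrite mulmxA mulmx_colsub mulmx1.
move=> i; have [j0 /eqP gj0|none] := pickP (fun j => g j == i); last first.
  rewrite !mxE big1 ?normr0 ?ler0z // => j _.
  by rewrite !mxE eq_sym none mul0r.
have -> : (colsub g 1%:M *m y) i 0 = y j0 0.
  rewrite mxE (bigD1 j0) //= big1 ?addr0 => [|j jj0].
    by rewrite !mxE gj0 eqxx mul1r.
  by rewrite !mxE -gj0 (inj_eq gI) eq_sym (negPf jj0) mul0r.
(* [Dj] is [D] with column [j0] replaced by minus the right-hand side. *)
pose D := mxsub f g A.
pose h j := if j == j0 then rshift n ord0 else lshift 1 (g j).
have hI : injective h.
  move=> j k; rewrite /h; case: eqP => [->|_]; case: eqP => [->|_] // /eqP.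
  - by rewrite eq_rlshift.
  - by rewrite eq_lrshift.
  - by rewrite eq_lshift => /eqP/gI.
pose Dj := mxsub f h (row_mx A (- b)).
have cramer : (\det Dj)%:~R = - (\det D)%:~R * y j0 0.
  have D'y : map_mx intr D *m y = rowsub f b'.
    by rewrite -yE -mul_rowsub_mx -mxsub_comp map_mxsub.
  have : \adj (map_mx intr D) *m (map_mx intr D *m y)
         = \adj (map_mx intr D) *m rowsub f b' by rewrite D'y.
  rewrite mulmxA mul_adj_mx mul_scalar_mx det_map_mx => /colP/(_ j0).
  rewrite !mxE mulNr => ->.
  rewrite (expand_det_col _ j0) rmorph_sum -sumrN /=; apply: eq_bigr => k _.
  have -> : Dj k j0 = - b (f k) 0 by rewrite mxE /h eqxx row_mxEr mxE.
  have -> : cofactor Dj k j0 = cofactor D k j0.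
    rewrite /cofactor; congr (_ * \det _); apply/matrixP=> s t.
    by rewrite 3!mxE /h eq_sym (negPf (neq_lift _ _)) row_mxEl !mxE.
  by rewrite !mxE cofactor_map_mx mulNr rmorphN rmorphM mulrC.
have detD_ge1 : 1 <= `|\det D|.
  rewrite -gtz0_ge1 normr_gt0; move: unitD.
  by rewrite -map_mxsub unitmxE det_map_mx unitfE intr_eq0.
have := minor_le r f h fI hI; rewrite -(ler_int rat) intr_norm cramer.
rewrite normrM normrN; apply: le_trans; rewrite ler_peMl // -intr_norm.
by rewrite -[1]/(1%:~R) ler_int.
Qed.

(** * The linear system of a list of equations *)

Definition is_sum n (e : equation n) : bool :=
  if e is SumEq _ _ _ then true else false.

Definition coef n (e : equation n) (v : 'I_n) : int :=
  match e with
  | SumEq i j k => (i == v)%:R + (j == v)%:R - (k == v)%:R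
  | OneEq l => (l == v)%:R
  end.

Definition rhs n (e : equation n) : int := (~~ is_sum e)%:R.

Definition coef_mx n m (S : m.-tuple (equation n)) : 'M[int]_(m, n) :=
  \matrix_(q, v) coef (tnth S q) v.

Definition rhs_mx n m (S : m.-tuple (equation n)) : 'cV[int]_m :=
  \col_q rhs (tnth S q).

Lemma satisfiesE (F : nzRingType) n (x : 'I_n -> F) (e : equation n) :
  satisfies x e <-> \sum_v (coef e v)%:~R * x v = (rhs e)%:~R.
Proof.
have pick i : \sum_v (i == v)%:R * x v = x i.
  rewrite (bigD1 i) //= eqxx mul1r big1 ?addr0 // => v vi.
  by rewrite eq_sym (negPf vi) mul0r.
case: e => [i j k|l] /=.
- have -> : \sum_v ((i == v)%:R + (j == v)%:R - (k == v)%:R)%:~R * x v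
            = x i + x j - x k.
    rewrite -(pick i) -(pick j) -(pick k) -big_split -sumrB /=.
    apply: eq_bigr => v _.
    by rewrite rmorphB rmorphD !rmorph_nat mulrBl mulrDl.
  by split=> [->|/eqP]; [rewrite subrr | rewrite subr_eq0 => /eqP].
- suff -> : \sum_v ((l == v)%:R : int)%:~R * x v = x l by [].
  by rewrite -(pick l); apply: eq_bigr => v _; rewrite rmorph_nat.
Qed.

Lemma is_solutionE (F : nzRingType) n m (S : m.-tuple (equation n))
    (x : 'I_n -> F) :
  is_solution S x <->
  map_mx intr (coef_mx S) *m \col_v x v = map_mx intr (rhs_mx S).
Proof.
have lhsE q : (map_mx intr (coef_mx S) *m \col_v x v) q 0
              = \sum_v (coef (tnth S q) v)%:~R * x v.
  by rewrite mxE; apply: eq_bigr => v _; rewrite !mxE.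
split=> [sol|/colP eqn q].
  by apply/colP=> q; rewrite lhsE !mxE; apply/satisfiesE; exact: sol.
by apply/satisfiesE; rewrite -lhsE eqn !mxE.
Qed.

(** The row of [x_i + x_j = x_k] is [e_i] plus [e_j - e_k], and that of
    [x_l = 1] is [e_l - e_c], where [c] is the column of the right-hand side. *)
Lemma augmented_row n m (S : m.-tuple (equation n)) q :
  exists u v : 'rV[int]_(n + 1),
    [/\ network u, network v,
        row q (row_mx (coef_mx S) (- rhs_mx S)) = u + v
      & ~~ is_sum (tnth S q) -> v = 0].
Proof.
pose net (a b : option 'I_(n + 1)) : 'rV[int]_(n + 1) :=
  \row_k ((a == Some k)%:R - (b == Some k)%:R).
have netP a b : network (net a b) by exists a, b => k; rewrite mxE.
pose L (i : 'I_n) := Some (lshift 1 i).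
have L1 i v : (L i == Some (lshift 1 v)) = (i == v).
  by rewrite (inj_eq Some_inj) eq_lshift.
have L2 i (v : 'I_1) : (L i == Some (rshift n v)) = false.
  by rewrite (inj_eq Some_inj) eq_lrshift.
have R1 (v : 'I_n) : (Some (rshift n ord0) == Some (lshift 1 v)) = false.
  by rewrite (inj_eq Some_inj) eq_rlshift.
pose u := if tnth S q is OneEq l then net (L l) (Some (rshift n ord0)) else
          if tnth S q is SumEq i _ _ then net (L i) None else 0.
pose v := if tnth S q is SumEq _ j k then net (L j) (L k) else net None None.
have net0 : net None None = 0 by apply/rowP=> k; rewrite !mxE subrr.
exists u, v; rewrite /u /v; split.
- by case: (tnth S q).
- by case: (tnth S q).
- apply/rowP=> w; rewrite mxE; case: (split_ordP w) => k ->.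
    rewrite row_mxEl mxE; case: (tnth S q) => [i j l|l] /=.
      by rewrite !mxE !L1 subr0 addrA.
    by rewrite net0 addr0 mxE L1 R1 subr0.
  rewrite row_mxEr 2!mxE /rhs; case: (tnth S q) => [i j l|l] /=.
    by rewrite !mxE !L2 !subrr.
  by rewrite net0 addr0 mxE L2 (ord1 k) eqxx sub0r.
- by case: (tnth S q).
Qed.

(** The equation [q0] saves one factor 2: at most [m - 1] rows of the minor
    come from equations [x_i + x_j = x_k]. *)
Lemma augmented_minor n m (S : m.-tuple (equation n)) (q0 : 'I_m)
    r (f : 'I_r -> 'I_m) (g : 'I_r -> 'I_(n + 1)) :
  ~~ is_sum (tnth S q0) -> injective f -> injective g ->
  `|\det (mxsub f g (row_mx (coef_mx S) (- rhs_mx S)))| <= 2 ^+ (m - 1).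
Proof.
set M := row_mx _ _ => one fI gI.
pose P := [set i | is_sum (tnth S (f i))].
have rowE i : row i (mxsub f g M) = colsub g (row (f i) M).
  by apply/rowP=> k; rewrite !mxE.
have cardP : (#|P| <= m - 1)%N.
  rewrite -(card_imset _ fI) subn1 -ltnS.
  rewrite (@leq_trans m) ?leqSpred // -[X in (_ < X)%N]card_ord.
  apply: proper_card; apply/properP; split; first by apply/subsetP.
  exists q0 => //; apply/imsetP=> - [i]; rewrite inE => + q0E.
  by rewrite -q0E (negPf one).
apply: le_trans (_ : 2 ^+ #|P| <= _); last by rewrite ler_weXn2l ?ler1n.
apply: norm_det_network_sum => i; rewrite inE rowE => isum;
    have [u [v [netu netv -> v0]]] := augmented_row S (f i).
  by rewrite v0 // addr0; apply: network_colsub.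
exists (colsub g u), (colsub g v); split; try exact: network_colsub.
by apply/rowP=> k; rewrite !mxE.
Qed.

(** If no equation is of the form [x_l = 1], the system is homogeneous and zero
    is a solution; otherwise [augmented_minor] applies. *)
Lemma small_rational_solution (R : numFieldType) n m
    (S : m.-tuple (equation n)) :
  (exists x : 'I_n -> R, is_solution S x) ->
  exists x : 'I_n -> rat,
    is_solution S x /\ forall i, `|x i| <= 2 ^+ (m - 1).
Proof.
case=> z zS.
have [/existsP[q0 one]|all_sum] := boolP [exists q, ~~ is_sum (tnth S q)];
  last first.
  exists (fun=> 0); split=> [q|i]; last by rewrite normr0 exprn_ge0.
  move: all_sum; rewrite negb_exists => /forallP/(_ q).
  by case: (tnth S q) => //= i j k _; rewrite addr0.
have [||x [xS x_le]] := @rational_solution_of_minors R _ _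
    (coef_mx S) (rhs_mx S) (2 ^+ (m - 1)).
- by move=> r f g; exact: augmented_minor one.
- by exists (\col_v z v); apply/is_solutionE.
exists (fun v => x v 0); split=> [|i].
  apply/is_solutionE; rewrite -xS; congr (_ *m _).
  by apply/colP=> v; rewrite mxE.
by apply: le_trans (x_le i) _; rewrite rmorphXn /=.
Qed.

(** * Sharpness: repeated doubling *)

Definition doubling_eq n (q : 'I_n) : equation n :=
  if val q == 0 then OneEq q else SumEq (ord_pred q) (ord_pred q) q.

Definition doubling_system n : n.-tuple (equation n) :=
  [tuple doubling_eq q | q < n].

Lemma doubling_solution (F : nzRingType) n (x : 'I_n -> F) :
  is_solution (doubling_system n) x <-> forall i : 'I_n, x i = 2 ^+ i.
Proof.
have predE (q : 'I_n) : val q != 0 -> val (ord_pred q) = q.-1.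
  case: q => -[//|q] ltq _; rewrite /= modnDr modn_small //.
  exact: ltnW.
split=> [sol [i]|xE q]; last first.
  rewrite tnth_mktuple /doubling_eq; case: ifPn => [/eqP q0|q0] /=.
    by rewrite xE q0.
  rewrite !xE predE // -mulr2n -[LHS]mulr_natl -exprS prednK //.
  by rewrite lt0n.
elim: i => [|i IHi] lti; have := sol (Ordinal lti);
  rewrite tnth_mktuple /doubling_eq /=; [by move=> -> | move=> <-].
have -> : ord_pred (Ordinal lti) = Ordinal (ltnW lti).
  by apply: val_inj; rewrite predE.
by rewrite IHi exprS mulr_natl mulr2n.
Qed.

Theorem mainTheorem3 (R : realType) (n : nat) (hn : (2 <= n)%N) :
  (forall S : n.-tuple (equation n),
     solvable R S ->
     exists x : 'I_n -> rat,
       is_solution S x /\ forall i : 'I_n, `|x i| <= 2 ^+ (n - 1))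
  /\
  (exists S : n.-tuple (equation n),
     solvable R S /\
     forall x : 'I_n -> R,
       is_solution S x ->
       \big[Num.max/0]_(i < n) `|x i| = 2 ^+ (n - 1)).
Proof.
split=> [S [x xS]|]; first by apply: (@small_rational_solution R); exists x.
exists (doubling_system n); split=> [|x /doubling_solution xE].
  by exists (fun i => 2 ^+ i); apply/doubling_solution.
have n_gt0 : (n - 1 < n)%N by rewrite subn1 prednK // ltnW.
apply/le_anti/andP; split.
  apply: (big_ind (fun y => y <= 2 ^+ (n - 1))) => [|a b|i _].
  - exact: exprn_ge0.
  - by rewrite ge_max => -> ->.
  - rewrite xE normrX normr_nat ler_weXn2l ?ler1n //.
    by rewrite -ltnS subn1 prednK // ltnW.
rewrite (bigD1 (Ordinal n_gt0)) //= le_max xE normrX normr_nat.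
by rewrite lexx.
Qed.
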